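(* Let $(\mathfrak{g}_1,J_1,k_1)$ and $(\mathfrak{g}_2,J_2,k_2)$ be two Hermitian Lie algebras and let $\rho_1:\mathfrak{g}_1\to \mathrm{Der}(\mathfrak{g}_2)$ and $\rho_2:\mathfrak{g}_2\to\mathrm{Der}(\mathfrak{g}_1)$ form a representation compatible couple such that $\rho_1(x)$ commutes with $J_2$ for all $x\in\mathfrak{g}_1$ and $\rho_2(a)$ commutes with $J_1$ for all $a\in\mathfrak{g}_2$. Then the Hermitian twisted cartesian product $(\mathfrak{g}_{(\rho_1,\rho_2)},J,K)$ is Kählerian if and only if $(\mathfrak{g}_i,J_i,k_i)$ is Kählerian and $\rho_i=-\rho_i^*$ for each $i\in\{1,2\}$.
   Context: All Lie algebras are real and finite-dimensional. A Hermitian Lie algebra $(\mathfrak{g},J,k)$ is a Lie algebra $\mathfrak{g}$ with an endomorphism $J$, $J^2=-\mathrm{Id}$, that is integrable (the Nijenhuis tensor $N_J(u,v)=[Ju,Jv]-[u,v]-J([Ju,v]+[u,Jv])$ vanishes), and a scalar product (positive definite) $k$ with $k(J\cdot,J\cdot)=k(\cdot,\cdot)$. Its fundamental form is $\omega(u,v)=k(Ju,v)$; it is Kählerian if $d\omega=0$, where $d\omega(u,v,w)=-\omega([u,v],w)+\omega([u,w],v)-\omega([v,w],u)$. $\mathrm{Der}(\mathfrak{g})$ is the Lie algebra of derivations of $\mathfrak{g}$. Two Lie algebra representations $\rho_1:\mathfrak{g}_1\to\mathrm{Der}(\mathfrak{g}_2)$, $\rho_2:\mathfrak{g}_2\to\mathrm{Der}(\mathfrak{g}_1)$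 form a representation compatible couple $(\rho_1,\rho_2)$ if $$\rho_1(\rho_2(a)x)b=\rho_1(\rho_2(b)x)a,\qquad \rho_2(\rho_1(x)a)y=\rho_2(\rho_1(y)a)x$$ for all $x,y\in\mathfrak{g}_1$, $a,b\in\mathfrak{g}_2$. The twisted cartesian product $\mathfrak{g}_{(\rho_1,\rho_2)}$ is then the Lie algebra with underlying space $\mathfrak{g}_1\oplus\mathfrak{g}_2$ and bracket $[x,y]=[x,y]_1$, $[a,b]=[a,b]_2$, $[x,a]=\rho_1(x)a-\rho_2(a)x$ for $x,y\in\mathfrak{g}_1$, $a,b\in\mathfrak{g}_2$. It is equipped with $K(x+a,y+b)=k_1(x,y)+k_2(a,b)$ and $J(x+a)=J_1x+J_2a$. When $\rho_1(x)$ commutes with $J_2$ and $\rho_2(a)$ commutes with $J_1$ for all $x\in\mathfrak{g}_1,a\in\mathfrak{g}_2$, $(\mathfrak{g}_{(\rho_1,\rho_2)},J,K)$ is a Hermitian Lie algebra, called the Hermitian twisted cartesian product. $\rho_1^*(x)$ denotes the adjoint of $\rho_1(x)$ with respect to $k_2$, and $\rho_2^*(a)$ the adjoint of $\rho_2(a)$ with respect to $k_1$; $\rho_i=-\rho_i^*$ means $\rho_i(u)=-\rho_i^*(u)$ for all $u\in\mathfrak{g}_i$. *)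

(* Defs.v *)
From HB Require Import structures.
From mathcomp Require Import all_boot all_order all_algebra.
From mathcomp Require Import reals.
From mathcomp Require Import ring.

Set Implicit Arguments.
Unset Strict Implicit.
Unset Printing Implicit Defensive.

Import Order.TTheory GRing.Theory Num.Theory.
Local Open Scope ring_scope.

Reserved Notation "[ 'lie' x , y ]" (format "[ 'lie'  x ,  y ]").

HB.mixin Record isLieAlgebra (R : realType) g of Vector R g := {
  bracket : {bilinear g -> g -> g};
  bracketxx : forall x, bracket x x = 0;
  jacobi : forall x y z,
    bracket x (bracket y z) + bracket y (bracket z x)
    + bracket z (bracket x y) = 0
}.

#[short(type="lieAlgType")]
HB.structure Definition LieAlgebra (R : realType) :=
  {g of isLieAlgebra R g & Vector R g}.

Notation "[ 'lie' x , y ]" := (bracket x y) : ring_scope.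

Definition nijenhuis (R : realType) (g : lieAlgType R) (J : 'End(g)) (u v : g) :=
  [lie J u, J v] - [lie u, v] - J ([lie J u, v] + [lie u, J v]).

HB.mixin Record isHermitianLie (R : realType) g of LieAlgebra R g := {
  cstruct : 'End(g);
  metric : {dot g for idfun};
  cstructK : forall u, cstruct (cstruct u) = - u;
  cstruct_integrable : forall u v, nijenhuis cstruct u v = 0;
  metricJ : forall u v, metric (cstruct u) (cstruct v) = metric u v
}.

#[short(type="hermLieAlgType")]
HB.structure Definition HermitianLie (R : realType) :=
  {g of isHermitianLie R g & LieAlgebra R g}.

Definition fundamental_form (R : realType) (g : hermLieAlgType R) (u v : g) : R :=
  metric (cstruct u) v.

Definition dform2 (R : realType) (g : lieAlgType R) (w : g -> g -> R) (u v z : g) : R :=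
  - w [lie u, v] z + w [lie u, z] v - w [lie v, z] u.

Definition kahlerian (R : realType) (g : hermLieAlgType R) : Prop :=
  forall u v z : g, dform2 (@fundamental_form R g) u v z = 0.

(* The adjoint is defined through the Riesz isomorphism V -> V^*, which is
   [flat]; [adjointP] and [adjoint_unique] characterise it. *)
Section Adjoint.
Variables (R : realType) (V : vectType R) (k : {dot V for idfun}).

Definition flat : 'Hom(V, 'Hom(V, R^o)) :=
  linfun (fun v => linfun (k v : V -> R^o)).

Definition adjoint (f : 'End(V)) : 'End(V) :=
  linfun (fun v => (flat^-1)%VF (flat v \o f)%VF).

Let k_linear v : linear (k v : V -> R^o).
Proof. by move=> a x y; rewrite linearPr. Qed.

Let flat_in v u : linfun (k v : V -> R^o) u = k v u.
Proof.
pose L := GRing.isLinear.Build R V R^o _ _ (k_linear v).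
pose f : {linear V -> R^o} := HB.pack (k v : V -> R^o) L.
by rewrite -[LHS]/(linfun f u) lfunE.
Qed.

Lemma flatE v u : flat v u = k v u.
Proof.
have lin : linear (fun v => linfun (k v : V -> R^o)).
  move=> a x y; apply/lfunP => z.
  by rewrite add_lfunE scale_lfunE !flat_in linearPl.
pose L := GRing.isLinear.Build R V 'Hom(V, R^o) _ _ lin.
pose f : {linear V -> 'Hom(V, R^o)} := HB.pack (fun v => linfun (k v : V -> R^o)) L.
by rewrite -[flat]/(linfun f) lfunE /= flat_in.
Qed.

Lemma dot_eq0 (v : V) : (forall u, k v u = 0) -> v = 0.
Proof.
move=> h; apply/eqP; apply: contraT => /(@neq0_dnorm_gt0 _ _ _ k).
by rewrite h ltxx.
Qed.

Lemma flatK phi : flat ((flat^-1)%VF phi) = phi.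
Proof.
apply: limg_lfunVK; suff -> : limg flat = fullv by rewrite memvf.
apply/eqP; rewrite eqEdim subvf /= limg_dim_eq; last first.
  apply/eqP; rewrite capfv -subv0; apply/subvP => v.
  rewrite memv_ker memv0 => /eqP h; apply/eqP/dot_eq0 => u.
  by rewrite -flatE h zero_lfunE.
by rewrite !dimvf /dim /= muln1.
Qed.

Lemma adjointP (f : 'End(V)) u v : k (f u) v = k u (adjoint f v).
Proof.
have sym x y : k x y = k y x by rewrite hermC expr0 mul1r.
have lin : linear (fun v => (flat^-1)%VF (flat v \o f)%VF).
  by move=> a x y; rewrite linearP comp_lfunDl -comp_lfunZl linearP.
pose L := GRing.isLinear.Build R V V _ _ lin.
pose h : {linear V -> V} := HB.pack (fun v => (flat^-1)%VF (flat v \o f)%VF) L.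
rewrite -[adjoint f]/(linfun h) lfunE /= sym [RHS]sym.
by rewrite -!flatE flatK comp_lfunE.
Qed.

Lemma adjoint_unique (f h : 'End(V)) : (forall u v, k (f u) v = k u (h v)) -> h = adjoint f.
Proof.
move=> fh; apply/lfunP => v; apply/subr0_eq/dot_eq0 => u.
have sym x y : k x y = k y x by rewrite hermC expr0 mul1r.
rewrite sym linearBr; apply/eqP; rewrite subr_eq0; apply/eqP.
exact: etrans (esym (fh u v)) (adjointP f u v).
Qed.

End Adjoint.

Definition derivation (R : realType) (g : lieAlgType R) (D : 'End(g)) : Prop :=
  forall x y, D [lie x, y] = [lie D x, y] + [lie x, D y].

Definition der_representation (R : realType) (g h : lieAlgType R)
    (rho : 'Hom(g, 'End(h))) : Prop :=
  (forall x, derivation (rho x)) /\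
  (forall x y, rho [lie x, y] = (rho x \o rho y)%VF - (rho y \o rho x)%VF).

Record compatible_couple (R : realType) (g1 g2 : lieAlgType R)
    (rho1 : 'Hom(g1, 'End(g2))) (rho2 : 'Hom(g2, 'End(g1))) : Prop := {
  compatible_rep1 : der_representation rho1;
  compatible_rep2 : der_representation rho2;
  compatible1 : forall (x : g1) (a b : g2),
    rho1 (rho2 a x) b = rho1 (rho2 b x) a;
  compatible2 : forall (x y : g1) (a : g2),
    rho2 (rho1 x a) y = rho2 (rho1 y a) x
}.

Definition commutes_with (R : realType) (V : vectType R) (f J : 'End(V)) : Prop :=
  forall v, f (J v) = J (f v).

Definition twisted_prod (R : realType) (g1 g2 : lieAlgType R)
    (rho1 : 'Hom(g1, 'End(g2))) (rho2 : 'Hom(g2, 'End(g1)))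
    (_ : compatible_couple rho1 rho2) : Type := (g1 * g2)%type.

Import VectorInternalTheory.

(* Reduces identities between vectors to identities between coordinates in R. *)
Lemma coordP (R : realType) (V : vectType R) (u v : V) :
  (forall i, v2r u 0 i = v2r v 0 i) -> u = v.
Proof. by move=> h; apply: (can_inj v2rK); apply/rowP. Qed.

Definition coordE (R : realType) (V : vectType R) :
    (forall i (u v : V), v2r (u + v) 0 i = v2r u 0 i + v2r v 0 i) *
    (forall i (u : V), v2r (- u) 0 i = - v2r u 0 i) *
    (forall i a (u : V), v2r (a *: u) 0 i = a * v2r u 0 i) *
    (forall i, v2r (0 : V) 0 i = 0).
Proof.
by do !split=> *; rewrite ?linearD ?linearN ?linearZ ?linear0 ?mxE.
Qed.

Section LieTheory.
Variables (R : realType) (g : lieAlgType R).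
Implicit Types x y z : g.

Lemma bracketDl x y z : [lie x + y, z] = [lie x, z] + [lie y, z].
Proof. exact: linearDl. Qed.

Lemma bracketDr x y z : [lie z, x + y] = [lie z, x] + [lie z, y].
Proof. exact: linearDr. Qed.

Lemma bracketNl x z : [lie - x, z] = - [lie x, z].
Proof. exact: linearNl. Qed.

Lemma bracketNr x z : [lie z, - x] = - [lie z, x].
Proof. exact: linearNr. Qed.

Lemma bracketC x y : [lie x, y] = - [lie y, x].
Proof.
have := bracketxx (x + y).
rewrite bracketDl !bracketDr !bracketxx add0r addr0 => /eqP.
by rewrite addr_eq0 => /eqP.
Qed.

End LieTheory.

Section HomTheory.
Variables (R : realType) (U V : vectType R) (rho : 'Hom(U, 'End(V))).

Lemma homD2 x y v : rho (x + y) v = rho x v + rho y v.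
Proof. by rewrite linearD add_lfunE. Qed.

Lemma homN2 x v : rho (- x) v = - rho x v.
Proof. by rewrite linearN opp_lfunE. Qed.

Lemma endD x u v : rho x (u + v) = rho x u + rho x v.
Proof. exact: linearD. Qed.

Lemma endN x v : rho x (- v) = - rho x v.
Proof. exact: linearN. Qed.

End HomTheory.

Section TwistedProduct.
Variables (R : realType) (g1 g2 : lieAlgType R).
Variables (rho1 : 'Hom(g1, 'End(g2))) (rho2 : 'Hom(g2, 'End(g1))).
Variable c : compatible_couple rho1 rho2.
Local Notation T := (twisted_prod c).

HB.instance Definition _ := Vector.copy T (g1 * g2)%type.

(* The bilinear alternating extension of [x, y]_1, [a, b]_2 and
   [x, a] = rho1 x a - rho2 a x, components in g1 and g2 collected. *)
Definition twisted_bracket (p q : T) : T :=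
  ([lie p.1, q.1] - rho2 q.2 p.1 + rho2 p.2 q.1,
   [lie p.2, q.2] + rho1 p.1 q.2 - rho1 q.1 p.2).

Let twisted_bilinear : bilinear_for
  (GRing.Scale.Law.clone _ _ *:%R _) (GRing.Scale.Law.clone _ _ *:%R _)
  twisted_bracket.
Proof.
split=> [q|p] a [u1 u2] [v1 v2]; rewrite /twisted_bracket /=; congr pair;
  rewrite ?linearPl ?linearPr !linearP !(add_lfunE, scale_lfunE) /=;
  by apply: coordP => i; rewrite !coordE; ring.
Qed.

HB.instance Definition _ := bilinear_isBilinear.Build R T T T _ _
  twisted_bracket twisted_bilinear.

Let twisted_xx p : twisted_bracket p p = 0.
Proof.
rewrite /twisted_bracket !bracketxx; congr pair;
  by apply: coordP => i; rewrite !coordE; ring.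
Qed.

Let twisted_jacobi p q r :
  twisted_bracket p (twisted_bracket q r) + twisted_bracket q (twisted_bracket r p)
  + twisted_bracket r (twisted_bracket p q) = 0.
Proof.
case: c => -[d1 m1] [d2 m2] c1 c2.
case: p q r => [x a] [y b] [z e]; rewrite /twisted_bracket /=.
have M1 u v t : rho1 [lie u, v] t = rho1 u (rho1 v t) - rho1 v (rho1 u t).
  by rewrite m1 add_lfunE opp_lfunE !comp_lfunE.
have M2 u v t : rho2 [lie u, v] t = rho2 u (rho2 v t) - rho2 v (rho2 u t).
  by rewrite m2 add_lfunE opp_lfunE !comp_lfunE.
congr pair; rewrite /=.
- rewrite !(bracketDr, bracketNr, homD2, homN2, endD, endN, M2, d2 _ _ _).
  rewrite (c2 y z a) (c2 z x b) (c2 x y e).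
  rewrite (bracketC (rho2 a y)) (bracketC (rho2 b z)) (bracketC (rho2 e x)).
  by apply: coordP => i; rewrite -(jacobi x y z) !coordE; ring.
- rewrite !(bracketDr, bracketNr, homD2, homN2, endD, endN, M1, d1 _ _ _).
  rewrite (c1 x b e) (c1 y e a) (c1 z a b).
  rewrite (bracketC (rho1 x b)) (bracketC (rho1 y e)) (bracketC (rho1 z a)).
  by apply: coordP => i; rewrite -(jacobi a b e) !coordE; ring.
Qed.

HB.instance Definition _ := isLieAlgebra.Build R T twisted_xx twisted_jacobi.

End TwistedProduct.

Definition hermitian_twisted_prod (R : realType) (g1 g2 : hermLieAlgType R)
    (rho1 : 'Hom(g1, 'End(g2))) (rho2 : 'Hom(g2, 'End(g1)))
    (c : compatible_couple rho1 rho2)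
    (_ : forall x, commutes_with (rho1 x) cstruct)
    (_ : forall a, commutes_with (rho2 a) cstruct) : Type :=
  twisted_prod c.

Section HermitianTwistedProduct.
Variables (R : realType) (g1 g2 : hermLieAlgType R).
Variables (rho1 : 'Hom(g1, 'End(g2))) (rho2 : 'Hom(g2, 'End(g1))).
Variable c : compatible_couple rho1 rho2.
Variable h1 : forall x, commutes_with (rho1 x) cstruct.
Variable h2 : forall a, commutes_with (rho2 a) cstruct.
Local Notation T := (hermitian_twisted_prod c h1 h2).

HB.instance Definition _ := LieAlgebra.copy T (twisted_prod c).

Definition twisted_cstruct_fun (p : T) : T := (cstruct p.1, cstruct p.2).

Definition twisted_cstruct : 'End(T) := linfun twisted_cstruct_fun.

Let twisted_cstruct_linear : linear twisted_cstruct_fun.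
Proof. by move=> a [u1 u2] [v1 v2]; congr pair; rewrite /= linearP. Qed.

HB.instance Definition _ :=
  GRing.isLinear.Build R T T _ twisted_cstruct_fun twisted_cstruct_linear.

Lemma twisted_cstructE p : twisted_cstruct p = (cstruct p.1, cstruct p.2).
Proof. by rewrite lfunE. Qed.

Definition twisted_metric (p q : T) : R := metric p.1 q.1 + metric p.2 q.2.

Let twisted_metric_bilinear : bilinear_for
  (GRing.Scale.Law.clone _ _ *%R _) (GRing.Scale.Law.clone _ _ (idfun \; *%R) _)
  twisted_metric.
Proof.
split=> [q|p] a [u1 u2] [v1 v2]; rewrite /twisted_metric /=.
  by rewrite !linearPl; ring.
by rewrite !linearPr /=; ring.
Qed.

HB.instance Definition _ := bilinear_isBilinear.Build R T T R _ _
  twisted_metric twisted_metric_bilinear.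

Let twisted_metric_sym p q :
  twisted_metric p q = (-1) ^+ false * idfun (twisted_metric q p).
Proof.
by rewrite expr0 mul1r; congr (_ + _); rewrite hermC expr0 mul1r.
Qed.

HB.instance Definition _ := isHermitianSesquilinear.Build R T false idfun
  twisted_metric twisted_metric_sym.

Let twisted_metric_pos p : p != 0 -> 0 < twisted_metric p p.
Proof.
have ge0 (g : hermLieAlgType R) (x : g) : 0 <= metric x x.
  have [->|x0] := eqVneq x 0; first by rewrite linear0l.
  exact/ltW/neq0_dnorm_gt0.
case: p => x a; rewrite -pair_eqE negb_and /twisted_metric /= => /orP[x0|a0].
  by rewrite ltr_wpDr ?ge0// neq0_dnorm_gt0.
by rewrite ltr_wpDl ?ge0// neq0_dnorm_gt0.
Qed.

HB.instance Definition _ := isDotProduct.Build R T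
  twisted_metric twisted_metric_pos.

Let twisted_cstructK p : twisted_cstruct (twisted_cstruct p) = - p.
Proof. by case: p => x a; rewrite !twisted_cstructE /= !cstructK. Qed.

Let twisted_integrable p q : nijenhuis twisted_cstruct p q = 0.
Proof.
case: p q => [x a] [y b].
have := @cstruct_integrable _ g2 a b; have := @cstruct_integrable _ g1 x y.
rewrite /nijenhuis.
rewrite (twisted_cstructE (x, a)) (twisted_cstructE (y, b)) twisted_cstructE.
have JD (g : hermLieAlgType R) (u v : g) : cstruct (u + v) = cstruct u + cstruct v.
  exact: linearD.
have JN (g : hermLieAlgType R) (u : g) : cstruct (- u) = - cstruct u.
  exact: linearN.
move=> N1 N2; congr pair => /=.
- rewrite -N1 !(JD, JN) !h2 !cstructK.
  by apply: coordP => i; rewrite !coordE; ring.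
- rewrite -N2 !(JD, JN) !h1 !cstructK.
  by apply: coordP => i; rewrite !coordE; ring.
Qed.

Let twisted_metricJ p q :
  twisted_metric (twisted_cstruct p) (twisted_cstruct q) = twisted_metric p q.
Proof. by rewrite /twisted_metric !twisted_cstructE !metricJ. Qed.

HB.instance Definition _ := isHermitianLie.Build R T
  twisted_cstructK twisted_integrable twisted_metricJ.

End HermitianTwistedProduct.

(* Main.v *)
Require Import Defs.
From mathcomp Require Import all_boot all_order all_algebra.
From mathcomp Require Import reals.
From mathcomp Require Import ring.

(** The differential of the fundamental form [w] of the twisted product is the
    sum of [dw1], [dw2] and of mixed terms, each of the shape
      [w (f u) v - w (f v) u]   with [f = rho_i t],
    that is, the antisymmetrization of the bilinear form [w (f u) v]
    ([dform2_twisted]). When [f] commutes with [J], it equals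
    [k (f (J u)) v + k (J u) (f v)], so, [J] being onto, it vanishes
    identically iff [f] is skew-adjoint ([form_alt_eq0P]). Hence the conditions
    on the factors make [dw] vanish. Conversely they are all recovered by
    evaluating [dw] on homogeneous vectors: triples in one factor give [dw1] and
    [dw2], and triples with one vector in a factor and two in the other isolate
    a single mixed term. *)

Import GRing.Theory.
Local Open Scope ring_scope.

Set Implicit Arguments.
Unset Strict Implicit.

Section SkewAdjoint.
Variables (R : realType) (V : vectType R) (k : {dot V for idfun}).

Lemma dotC u v : k u v = k v u.
Proof. by rewrite hermC expr0 mul1r. Qed.

Lemma skew_adjointP (f : 'End(V)) :
  (forall u v, k (f u) v + k u (f v) = 0) <-> f = - adjoint k f.
Proof.
split=> [skew|fE u v].
  rewrite -[LHS]opprK; congr (- _); apply: adjoint_unique => u v.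
  by rewrite opp_lfunE linearNr; apply/eqP; rewrite -addr_eq0 skew.
by rewrite adjointP {2}fE opp_lfunE linearNr subrr.
Qed.

End SkewAdjoint.

Section FormAlt.
Variables (R : realType) (g : hermLieAlgType R).
Implicit Types (f : 'End(g)) (u v w : g).

Lemma metric_cstructl u v : metric (cstruct u) v = - metric u (cstruct v).
Proof. by rewrite -[in RHS]metricJ cstructK linearNr opprK. Qed.

Lemma fundamental_formDl u v w :
  fundamental_form (u + v) w = fundamental_form u w + fundamental_form v w.
Proof. by rewrite /fundamental_form linearD linearDl. Qed.

Lemma fundamental_formNl u w : fundamental_form (- u) w = - fundamental_form u w.
Proof. by rewrite /fundamental_form linearN linearNl. Qed.

Lemma dform2_fundamental0r u v : dform2 (@fundamental_form R g) u v 0 = 0.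
Proof.
rewrite /dform2 /fundamental_form !linear0r !(linear0, linear0l).
by rewrite !(oppr0, addr0).
Qed.

Definition form_alt f u v : R :=
  fundamental_form (f u) v - fundamental_form (f v) u.

Lemma form_alt0r f u : form_alt f u 0 = 0.
Proof. by rewrite /form_alt /fundamental_form !linear0 linear0l subrr. Qed.

Lemma form_alt0l f v : form_alt f 0 v = 0.
Proof. by rewrite /form_alt /fundamental_form !linear0 linear0l subrr. Qed.

Lemma form_alt_zero u v : form_alt 0 u v = 0.
Proof. by rewrite /form_alt /fundamental_form !zero_lfunE linear0 !linear0l subrr. Qed.

Lemma form_altE f u v : commutes_with f cstruct ->
  form_alt f u v = metric (f (cstruct u)) v + metric (cstruct u) (f v).
Proof.
move=> fJ; rewrite /form_alt /fundamental_form fJ (metric_cstructl (f v)).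
by rewrite opprK (dotC _ _ (cstruct u)).
Qed.

(** The two conditions differ by the substitution of [J u] for [u], which is
    invertible since [u = J (- J u)]. *)
Lemma form_alt_eq0P f : commutes_with f cstruct ->
  (forall u v, form_alt f u v = 0) <-> f = - adjoint metric f.
Proof.
move=> fJ; rewrite -skew_adjointP; split=> [alt0 u v|skew u v]; last first.
  by rewrite form_altE.
by have := alt0 (- cstruct u) v; rewrite form_altE // (linearN cstruct) /= cstructK opprK.
Qed.

End FormAlt.

Section TwistedForm.
Variables (R : realType) (g1 g2 : hermLieAlgType R).
Variables (rho1 : 'Hom(g1, 'End(g2))) (rho2 : 'Hom(g2, 'End(g1))).
Variable c : compatible_couple rho1 rho2.
Variable h1 : forall x, commutes_with (rho1 x) cstruct.
Variable h2 : forall a, commutes_with (rho2 a) cstruct.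
Local Notation T := (hermitian_twisted_prod c h1 h2).

Lemma fundamental_form_twisted (p q : T) :
  fundamental_form p q = fundamental_form p.1 q.1 + fundamental_form p.2 q.2.
Proof.
rewrite /fundamental_form -[LHS]/(twisted_metric (twisted_cstruct c h1 h2 p) q).
by rewrite twisted_cstructE.
Qed.

(** The three brackets contribute four summands [rho1 _ _] or [rho2 _ _] each;
    [form_alt] pairs the two in which the same vector acts. *)
Lemma dform2_twisted (x y z : g1) (a b e : g2) :
  dform2 (@fundamental_form R T) ((x, a) : T) ((y, b) : T) ((z, e) : T) =
    dform2 (@fundamental_form R g1) x y z
    + dform2 (@fundamental_form R g2) a b e
    - form_alt (rho2 a) y z + form_alt (rho2 b) x z - form_alt (rho2 e) x y
    - form_alt (rho1 x) b e + form_alt (rho1 y) a e - form_alt (rho1 z) a b.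
Proof.
rewrite /dform2 !fundamental_form_twisted /= /form_alt.
by rewrite !(fundamental_formDl, fundamental_formNl); ring.
Qed.

End TwistedForm.

Unset Implicit Arguments.

Theorem corollary2p1 (R : realType) (g1 g2 : hermLieAlgType R)
    (rho1 : 'Hom(g1, 'End(g2))) (rho2 : 'Hom(g2, 'End(g1)))
    (c : compatible_couple rho1 rho2)
    (h1 : forall x : g1, commutes_with (rho1 x) cstruct)
    (h2 : forall a : g2, commutes_with (rho2 a) cstruct) :
  kahlerian (hermitian_twisted_prod c h1 h2) <->
  (kahlerian g1 /\ (forall x : g1, rho1 x = - adjoint metric (rho1 x))) /\
  (kahlerian g2 /\ (forall a : g2, rho2 a = - adjoint metric (rho2 a))).
Proof.
split=> [K|[[K1 S1] [K2 S2]] [x a] [y b] [z e]]; last first.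
  have A1 t := (form_alt_eq0P (h1 t)).2 (S1 t).
  have A2 t := (form_alt_eq0P (h2 t)).2 (S2 t).
  by rewrite dform2_twisted !(A1, A2) K1 K2; ring.
have D x y z a b e := etrans (esym (dform2_twisted c h1 h2 x y z a b e))
  (K (x, a) (y, b) (z, e)).
have simp := (linear0, @form_alt_zero, @form_alt0l, @form_alt0r, @dform2_fundamental0r,
  subr0, addr0, add0r).
have K1 : kahlerian g1.
  by move=> u v w; have := D u v w 0 0 0; rewrite !simp.
have K2 : kahlerian g2.
  by move=> u v w; have := D 0 0 0 u v w; rewrite !simp.
(* The acting vector goes in the middle slot, where its mixed term has sign +. *)
split; split=> // t; apply/form_alt_eq0P => // u v.
- by have := D 0 t 0 u 0 v; rewrite K1 K2 !simp.
- by have := D u 0 v 0 t 0; rewrite K1 K2 !simp.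
Qed.
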